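(* Let $a$ be a constant and consider, with parameter $t$, the functions $y(t)=a-t-1$ and $x(t)=(a-t-1)^2$. Then $y$, as a function of $x$, is a solution of the Painlevé VI equation with parameters $(\alpha,\beta,\gamma,\delta)=\left(\frac18,-\frac18,\frac18,\frac38\right)$. (Here $y(t)=-y_0(t)$, where $y_0(t)=-(a-t-1)$.)
   Context: The Painlevé VI equation with parameters $(\alpha,\beta,\gamma,\delta)$ is $$\frac{d^2 y}{dx^2} = \frac{1}{2} \left( \frac{1}{y} + \frac{1}{y-1}+ \frac{1}{y-x} \right) \left( \frac{dy}{dx} \right)^2 - \left( \frac{1}{x} + \frac{1}{x-1} + \frac{1}{y-x} \right) \frac{dy}{dx}+ \frac{y(y-1)(y-x)}{x^2(x-1)^2}\left( \alpha +\beta\frac{x}{y^2} + \gamma\frac{x-1}{(y-1)^2} + \delta\frac{x(x-1)}{(y-x)^2} \right).$$ ''$y$ as a function of $x$'' means that $y$ is regarded locally as a function of $x$ through the parameter $t$, where $dx/dt\neq0$ and the terms of the equation are defined ($x\ne0,1$; $y\neq 0,1,x$). The function $y_0$ arises from the circle $\Gamma_0: X^2+Y^2=1$ and the confocal conics $\mathcal{C}(t):\frac{X^2}{a-t}+\frac{Y^2}{a-t-1}=1$ as follows: the cubic $\mu^2=-(\lambda+1)(\lambda(a-t)+1)(\lambda(a-t-1)+1)$ has finite ramification points $\lambda_1=\frac1{t-a}$, $\lambda_2=\frac1{t-a+1}$, $\lambda_3=-1$; with $\phi_t(\lambda)=\frac{\lambda-\lambda_1}{\lambda_2-\lambda_1}$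 one has $x=\phi_t(\lambda_3)$ and $y_0=\phi_t(0)$. *)

(* Defs.v *)
From HB Require Import structures.
From mathcomp Require Import all_boot all_order all_algebra.
From mathcomp Require Import complex.
From mathcomp Require Import boolp classical_sets reals topology normedtype derive.

Set Implicit Arguments.
Unset Strict Implicit.
Unset Printing Implicit Defensive.

Import Order.TTheory GRing.Theory Num.Theory.
Import numFieldNormedType.Exports.
Local Open Scope classical_set_scope.
Local Open Scope ring_scope.

(* The analytic notions are stated over a numFieldType K, whose topology is the
   one given by its norm; for K = R[i], [derivable f z 1] and [derive1 f] are complex
   differentiability and the complex derivative. *)

Definition PVI_rhs (K : numFieldType) (alpha beta gamma delta x y p : K) : K :=
  2^-1 * (y^-1 + (y - 1)^-1 + (y - x)^-1) * p ^+ 2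
  - (x^-1 + (x - 1)^-1 + (y - x)^-1) * p
  + (y * (y - 1) * (y - x)) / (x ^+ 2 * (x - 1) ^+ 2)
    * (alpha + beta * (x / y ^+ 2) + gamma * ((x - 1) / (y - 1) ^+ 2)
       + delta * ((x * (x - 1)) / (y - x) ^+ 2)).

Definition PVI_defined (K : numFieldType) (x y : K) : Prop :=
  [/\ x != 0, x != 1, y != 0, y != 1 & y != x].

Definition PVI_solution_at (K : numFieldType) (alpha beta gamma delta : K)
    (Y : K -> K) (z : K) : Prop :=
  [/\ PVI_defined z (Y z),
      derivable Y z 1,
      derivable (derive1 Y) z 1
    & derive1 (derive1 Y) z = PVI_rhs alpha beta gamma delta z (Y z) (derive1 Y z)].

(* At every t0 with dx/dt <> 0 at which the equation makes sense, there is a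
   function Y, defined near x(t0), such that Y (x t) = y t for t near t0; it
   solves the equation on a neighbourhood of x(t0). The values of Y away from
   x(t0) are irrelevant. *)
Definition PVI_param_solution (K : numFieldType) (alpha beta gamma delta : K)
    (x y : K -> K) : Prop :=
  forall t0 : K, derive1 x t0 != 0 -> PVI_defined (x t0) (y t0) ->
  exists Y : K -> K,
    (\forall t \near t0, Y (x t) = y t) /\
    (\forall z \near x t0, PVI_solution_at alpha beta gamma delta Y z).

(* Finite ramification points of
   mu^2 = - (l + 1) (l (a - t) + 1) (l (a - t - 1) + 1). *)
Definition lambda1 (K : fieldType) (a t : K) : K := 1 / (t - a).
Definition lambda2 (K : fieldType) (a t : K) : K := 1 / (t - a + 1).
Definition lambda3 (K : fieldType) : K := -1.

Definition phi (K : fieldType) (a t l : K) : K :=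
  (l - lambda1 a t) / (lambda2 a t - lambda1 a t).

Definition y0 (K : fieldType) (a t : K) : K := phi a t 0.

(* Main.v *)
(** With [s = a - t - 1] the pair is [(x, y) = (s ^ 2, s)], so [y] is a local
branch of the square root of [x], with [y' = 1 / (2 y)] and
[y'' = - 1 / (4 y ^ 3)]. After substituting [x = y ^ 2] the equation becomes an
identity between rational functions of [y]. The branch near [s ^ 2] is the
root closer to [s] than [0] is; two such roots [u, v] stay away from being
opposite, so [(u - v) (u + v) = u ^ 2 - v ^ 2] yields its continuity and its
derivative. *)
Require Import Defs.
From HB Require Import structures.
From mathcomp Require Import all_boot all_order all_algebra.
From mathcomp Require Import complex.
From mathcomp Require Import boolp classical_sets reals topology normedtype derive.
From mathcomp Require Import ring.

Import Order.TTheory GRing.Theory Num.Theory.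
Import numFieldNormedType.Exports.
Local Open Scope ring_scope.

Lemma lerB_normD_near (K : numFieldType) (s u v : K) :
  2 * `|s| - `|u - s| - `|v - s| <= `|u + v|.
Proof.
rewrite -addrA -opprD lerBlDr -{1}(normr_nat K 2) -normrM.
have -> : 2 * s = (u + v) - ((u - s) + (v - s)) by ring.
by rewrite (le_trans (ler_normB _ _))// lerD2l ler_normD.
Qed.

Lemma near_dist_lt (K : numFieldType) (x e : K) :
  0 < e -> \forall z \near x, `|z - x| < e.
Proof.
by move=> e0; apply/nbhs_ballP; exists e => //= z; rewrite /ball /= distrC.
Qed.

Lemma near_neq (K : numFieldType) (x c : K) :
  x != c -> \forall z \near x, z != c.
Proof.
rewrite -subr_eq0 -normr_gt0 => /(near_dist_lt _ x).
apply: (@filterS _ (nbhs x)) => z; apply: contraTneq => ->.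
by rewrite distrC ltxx.
Qed.

Section SqrtBranch.
Context {K : numFieldType} {sq : K -> K} (sqK : forall z, sq z ^+ 2 = z).
Context {s : K} (s0 : s != 0).

(** [sq] is an arbitrary choice of square roots, with no continuity assumed; the test against [s]
    only repairs its sign. *)
Definition sqrt_branch (z : K) : K :=
  if `|sq z - s| < `|s| then sq z else - sq z.

Lemma sqr_sqrt_branch z : sqrt_branch z ^+ 2 = z.
Proof. by rewrite /sqrt_branch; case: ifP => _; rewrite ?sqrrN sqK. Qed.

Let s_gt0 : 0 < `|s|. Proof. by rewrite normr_gt0. Qed.

(** The product of the distances from [s] to [sq z] and to [- sq z] is [|z - s ^+ 2|], so the two
    cannot both reach [|s|]. *)
Lemma sqrt_branch_near z :
  `|z - s ^+ 2| < `|s| ^+ 2 -> `|sqrt_branch z - s| < `|s|.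
Proof.
move=> zs; rewrite /sqrt_branch; case: ifPn => // ge_s.
move: zs; rewrite -{1}(sqK z) subr_sqr normrM => zs.
rewrite -opprD normrN real_ltNge ?normr_real//; apply/negP => ge_s'.
move: ge_s; rewrite -real_leNgt ?normr_real// => ge_s.
have := ler_pM (ltW s_gt0) (ltW s_gt0) ge_s ge_s'.
by rewrite -expr2 real_leNgt ?zs// ?rpredX ?rpredM ?normr_real.
Qed.

(** A root within [|s|] of [s] has a sum with [s] of norm at least [|s|]; dividing [|z - s ^+ 2|] by
    that sum sharpens the bound on the distance. *)
Lemma sqrt_branch_near_half z :
  `|z - s ^+ 2| < `|s| ^+ 2 / 2 -> `|sqrt_branch z - s| < `|s| / 2.
Proof.
move=> zs.
have ys : `|sqrt_branch z - s| < `|s|.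
  apply: sqrt_branch_near; apply: (lt_trans zs).
  by rewrite ltr_pdivrMr ?ltr0n// ltr_pMr ?exprn_gt0// ltr1n.
rewrite -(ltr_pM2r s_gt0) mulrAC -expr2; apply: le_lt_trans zs.
rewrite -[z in leRHS]sqr_sqrt_branch subr_sqr normrM ler_wpM2l//.
apply: le_trans (lerB_normD_near _ s _ s).
rewrite subrr normr0 subr0 lerBrDr.
have -> : 2 * `|s| = `|s| + `|s| by ring.
by rewrite lerD2l ltW.
Qed.

(** Quantitative form of two nearby roots not being opposite: it makes the branch Lipschitz and
    keeps [2 * sqrt_branch w] away from zero. *)
Lemma le_normD_near_half (u v : K) :
  `|u - s| < `|s| / 2 -> `|v - s| < `|s| / 2 -> `|s| <= `|u + v|.
Proof.
move=> us vs; apply: le_trans (lerB_normD_near _ s u v).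
rewrite -addrA -opprD lerBrDr.
have -> : 2 * `|s| = `|s| + (`|s| / 2 + `|s| / 2) by field.
by rewrite lerD2l lerD// ltW.
Qed.

Lemma near_sqr_ball : \forall z \near s ^+ 2, `|z - s ^+ 2| < `|s| ^+ 2 / 2.
Proof.
by apply: near_dist_lt; rewrite divr_gt0 ?exprn_gt0.
Qed.

(** Both sides have the same square and lie near [s], so their sum is nonzero and their difference
    must vanish. *)
Lemma sqrt_branch_sqr_near : \forall t \near s, sqrt_branch (t ^+ 2) = t.
Proof.
have e0 : 0 < `|s| / 2 by rewrite divr_gt0.
have sqr_cvg : (t ^+ 2 @[t --> s] --> s ^+ 2)%classic.
  exact: (cvgM (@cvg_id _ (nbhs s)) (@cvg_id _ (nbhs s))).
have near_s := @near_dist_lt _ s _ e0.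
have near_s2 := sqr_cvg _ near_sqr_ball.
near=> t.
have ts : `|t - s| < `|s| / 2 by near: t.
have /sqrt_branch_near_half ys : `|t ^+ 2 - s ^+ 2| < `|s| ^+ 2 / 2 by near: t.
have yt0 : sqrt_branch (t ^+ 2) + t != 0.
  by rewrite -normr_gt0 (lt_le_trans s_gt0)// le_normD_near_half.
apply/eqP; rewrite -subr_eq0 -(mulIr_eq0 _ (mulIf yt0)) -subr_sqr.
by rewrite sqr_sqrt_branch subrr.
Unshelve. all: by end_near. Qed.

Lemma sqrt_branch_cvg w : `|w - s ^+ 2| < `|s| ^+ 2 / 2 ->
  (sqrt_branch z @[z --> w] --> sqrt_branch w)%classic.
Proof.
move=> ws; have yw := sqrt_branch_near_half _ ws.
apply/(@cvgrPdist_lt _ K _ (nbhs w)) => e e0.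
(* The radius [e * |s|] fits the Lipschitz constant [1 / |s|]: the difference of the roots times
   their sum is [z - w], and the sum has norm at least [|s|]. *)
have near_w := @near_dist_lt _ w _ (mulr_gt0 e0 s_gt0).
have near_s : \forall z \near w, `|z - s ^+ 2| < `|s| ^+ 2 / 2.
  have := @near_dist_lt _ w (`|s| ^+ 2 / 2 - `|w - s ^+ 2|).
  rewrite subr_gt0 => /(_ ws); apply: (@filterS _ (nbhs w)) => z zw.
  by rewrite -(subrKA w) (le_lt_trans (ler_normD _ _))// -ltrBrDr.
near=> z.
have zs : `|z - s ^+ 2| < `|s| ^+ 2 / 2 by near: z.
have yz := sqrt_branch_near_half _ zs.
rewrite distrC -(ltr_pM2r s_gt0).
apply: (@le_lt_trans _ _ `|z - w|); last by near: z.
rewrite -{2}(sqr_sqrt_branch z) -{2}(sqr_sqrt_branch w) subr_sqr normrM.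
by rewrite ler_wpM2l// le_normD_near_half.
Unshelve. all: by end_near. Qed.

Lemma is_derive_sqrt_branch w : `|w - s ^+ 2| < `|s| ^+ 2 / 2 ->
  is_derive w 1 sqrt_branch (2 * sqrt_branch w)^-1.
Proof.
move=> ws; have yw := sqrt_branch_near_half _ ws.
have y_neq0 : 2 * sqrt_branch w != 0.
  have -> : 2 * sqrt_branch w = sqrt_branch w + sqrt_branch w by ring.
  by rewrite -normr_gt0 (lt_le_trans s_gt0)// le_normD_near_half.
have shift_cvg : (h + w @[h --> (0 : K)^'] --> w)%classic.
  apply: cvg_trans (cvg_app _ (@nbhs_dnbhs _ _)) _.
  rewrite -{2}(add0r w); apply: cvgD; [exact: cvg_id | exact: cvg_cst].
have sum_cvg : (sqrt_branch (h + w) + sqrt_branch w @[h --> (0 : K)^']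
    --> 2 * sqrt_branch w)%classic.
  have -> : 2 * sqrt_branch w = sqrt_branch w + sqrt_branch w by ring.
  apply: cvgD; last exact: cvg_cst.
  exact: (cvg_comp _ _ shift_cvg (sqrt_branch_cvg _ ws)).
have sum_neq0 := cvgr_neq0 _ sum_cvg y_neq0.
have quot_cvg : (h^-1 *: ((sqrt_branch \o shift w) (h *: 1) - sqrt_branch w)
    @[h --> (0 : K)^'] --> (2 * sqrt_branch w)^-1)%classic.
  (* For [h != 0] the difference quotient is exactly the inverse of the sum of the two roots, whose
     limit is known by continuity. *)
  apply: cvg_trans (cvgV y_neq0 sum_cvg).
  apply: near_eq_cvg; near=> h.
  have h0 : h != 0 by near: h; exact: nbhs_dnbhs_neq.
  have yh0 : sqrt_branch (h + w) + sqrt_branch w != 0.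
    by near: h; exact: sum_neq0.
  rewrite /= /GRing.scale /= mulr1; apply: (mulIf yh0).
  rewrite mulVf// -mulrA -subr_sqr !sqr_sqrt_branch addrK mulVf//.
by apply: DeriveDef; [apply/cvg_ex; exists (2 * sqrt_branch w)^-1 | exact/cvg_lim].
Unshelve. all: by end_near. Qed.

End SqrtBranch.

Lemma PVI_rhs_sqrt (K : numFieldType) (y : K) :
  y != 0 -> y != 1 -> y != -1 ->
  PVI_rhs (1 / 8) (- (1 / 8)) (1 / 8) (3 / 8) (y ^+ 2) y (2 * y)^-1
    = - (4 * y ^+ 3)^-1.
Proof.
move=> y0 y1 yN1; rewrite /PVI_rhs.
have yB1 : y - 1 != 0 by rewrite subr_eq0.
have yD1 : y + 1 != 0 by rewrite addr_eq0.
(* Factoring [y - x] and [x - 1] at [x = y ^ 2] leaves only [y], [y - 1] and [y + 1] as denominators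
   for [field]. *)
have -> : y - y ^+ 2 = - (y * (y - 1)) by ring.
have -> : y ^+ 2 - 1 = (y - 1) * (y + 1) by ring.
field.
by rewrite y0 yB1 yD1.
Qed.

Lemma PVI_sqrt_solution_at (K : numFieldType) (Y : K -> K) (z : K) :
  z != 0 -> z != 1 ->
  (\forall w \near z, Y w ^+ 2 = w /\ is_derive w 1 Y (2 * Y w)^-1) ->
  PVI_solution_at (1 / 8) (- (1 / 8)) (1 / 8) (3 / 8) Y z.
Proof.
move=> z0 z1 nearY; have [Yz2 dY] := nbhs_singleton nearY.
have Y0 : Y z != 0 by apply: contra_neq z0 => Y0; rewrite -Yz2 Y0 expr0n.
have Y1 : Y z != 1 by apply: contra_neq z1 => Y1; rewrite -Yz2 Y1 expr1n.
have YN1 : Y z != -1.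
  by apply: contra_neq z1 => YN1; rewrite -Yz2 YN1 sqrrN expr1n.
(* A common value would satisfy [Y z ^+ 2 = Y z], forcing [Y z = 1]. *)
have Yz : Y z != z.
  apply: contra_neq Y1 => Yz; apply: (mulfI Y0).
  by rewrite mulr1 -expr2 Yz2.
(* The formula for the first derivative holds near [z], not just at [z], so it may be differentiated
   again. *)
have Y'E : \forall w \near z, (2 * Y w)^-1 = derive1 Y w.
  by apply: filterS nearY => w [_ dYw]; rewrite derive1E derive_val.
have dY' : is_derive z 1 (derive1 Y) (- (4 * Y z ^+ 3)^-1).
  apply: near_eq_is_derive Y'E _.
  have Y20 : 2 * Y z != 0 by rewrite mulf_neq0// pnatr_eq0.
  have d2Y : is_derive z 1 (fun w => 2 * Y w) (2 * (2 * Y z)^-1).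
    exact: (@is_deriveZ _ _ _ Y 2 z 1).
  apply: DeriveDef; first exact: (@derivableV _ _ (fun w => 2 * Y w)).
  rewrite (@deriveV _ _ (fun w => 2 * Y w))// derive_val /GRing.scale /=.
  by field.
split=> //.
rewrite (derive1E (derive1 Y)) derive_val derive1E derive_val.
by rewrite -PVI_rhs_sqrt// Yz2.
Qed.

Lemma PVI_param_solution_sqrt (K : numFieldType) (sq : K -> K)
    (sqK : forall z, sq z ^+ 2 = z) (a : K) :
  let y : K -> K := fun t => a - t - 1 in
  let x : K -> K := fun t => (a - t - 1) ^+ 2 in
  PVI_param_solution (1 / 8) (- (1 / 8)) (1 / 8) (3 / 8) x y.
Proof.
move=> y x t0 _ [x0 x1 y0 _ _].
exists (@sqrt_branch _ sq (y t0)); split.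
  have y_cvg : (y t @[t --> t0] --> y t0)%classic.
    apply/(@cvgrPdist_lt _ K _ (nbhs t0)) => e /(near_dist_lt _ t0).
    apply: (@filterS _ (nbhs t0)) => t.
    by rewrite (_ : y t0 - y t = t - t0)//; rewrite /y; ring.
  exact: (y_cvg _ (sqrt_branch_sqr_near sqK y0)).
(* Each [z] near [x t0] needs a whole neighbourhood on which the branch is differentiable. *)
have near_s := near_join (near_sqr_ball y0).
near=> z; apply: PVI_sqrt_solution_at;
  [by near: z; exact: near_neq | by near: z; exact: near_neq |].
have : \forall w \near z, `|w - y t0 ^+ 2| < `|y t0| ^+ 2 / 2 by near: z.
apply: filterS => w ws; split; first exact: sqr_sqrt_branch.
exact: is_derive_sqrt_branch.
Unshelve. all: by end_near. Qed.

(** The gap [lambda2 - lambda1] is [-1 / ((t - a) (t - a + 1))], so dividing by it clears all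
    denominators; [l = 0] and [l = -1] then give [y0] and [x]. *)
Lemma phiE (K : fieldType) (a t l : K) : t != a -> t != a - 1 ->
  phi a t l = (1 - l * (t - a)) * (t - a + 1).
Proof.
move=> ta ta1; have ta0 : t - a != 0 by rewrite subr_eq0.
have ta10 : t - a + 1 != 0.
  by rewrite (_ : _ + 1 = t - (a - 1)) ?subr_eq0//; ring.
have gap : lambda2 a t - lambda1 a t = - ((t - a) * (t - a + 1))^-1.
  by rewrite /lambda1 /lambda2; field; rewrite ta0 ta10.
by rewrite /phi gap invrN invrK /lambda1; field.
Qed.

Theorem theorem6p4 (R : realType) (a : R[i]) :
  let y : R[i] -> R[i] := fun t => a - t - 1 in
  let x : R[i] -> R[i] := fun t => (a - t - 1) ^+ 2 in
  PVI_param_solution (1 / 8) (- (1 / 8)) (1 / 8) (3 / 8) x y /\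
  (forall t : R[i], t != a -> t != a - 1 ->
     [/\ x t = phi a t (lambda3 _),
         y0 a t = - (a - t - 1)
       & y t = - y0 a t]).
Proof.
move=> y x; split; last first.
  move=> t ta ta1.
  have y0E : y0 a t = - (a - t - 1) by rewrite /y0 phiE//; ring.
  by split; rewrite ?y0E ?opprK// /x phiE// /lambda3; ring.
(* The complex square root serves as the global choice [sq]. *)
exact: (PVI_param_solution_sqrt _ _ (@sqr_sqrtc R)).
Qed.
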